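(* Let $f,g:\mathbb{R}^n\to\mathbb{R}$ be continuously differentiable, with $\|\nabla f(\mathbf{x})\|\le G_f<\infty$ for all $\mathbf{x}$, with $\nabla f$ $L_f$-Lipschitz and $\nabla g$ $L_g$-Lipschitz, and with $g$ attaining its minimum. Suppose that $g$ is twice differentiable with $\nabla^2 g$ $L_H$-Lipschitz and that $g$ satisfies the local error bound condition (see context). Then there is a constant $C>0$, depending only on the problem (that is, on the constants in these assumptions) and not on $\hat{\mathbf{x}},\lambda,\epsilon_f,\epsilon_g$, such that the following holds: if $\epsilon_f,\epsilon_g>0$ and $\hat{\mathbf{x}}\in\mathbb{R}^n$ is an $(\epsilon_f,\epsilon_g)$-stationary point of the problem $\min f(\mathbf{x})$ s.t. $\mathbf{x}\in\arg\min_{\mathbf{z}\in\mathbb{R}^n} g(\mathbf{z})$, with corresponding scalar $\lambda\ge 0$, then $\hat{\mathbf{x}}$ is an $(\epsilon_p,\epsilon_d)$-KKT point of the problem $\min f(\mathbf{x})$ s.t. $\nabla g(\mathbf{x})=0$, with $$\epsilon_p=C\left(\epsilon_f+\lambda\|\nabla g(\hat{\mathbf{x}})\|\,\epsilon_g\right),\qquad \epsilon_d=\epsilon_g.$$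
   Context: Norms are Euclidean (operator norm for matrices). $(\epsilon_f,\epsilon_g)$-stationary point with scalar $\lambda\ge0$: $\|\nabla g(\hat{\mathbf{x}})\|^2\le\epsilon_g$ and $\|\nabla f(\hat{\mathbf{x}})+\lambda\nabla g(\hat{\mathbf{x}})\|^2\le\epsilon_f$. $(\epsilon_p,\epsilon_d)$-KKT point of $\min f(\mathbf{x})$ s.t. $\nabla g(\mathbf{x})=0$: there exists $\mathbf{w}\in\mathbb{R}^n$ such that $\|\nabla f(\hat{\mathbf{x}})+\nabla^2 g(\hat{\mathbf{x}})\mathbf{w}\|^2\le\epsilon_p$ and $\|\nabla g(\hat{\mathbf{x}})\|^2\le\epsilon_d$. Local error bound condition: there exist $c>0$ and a threshold $\bar\epsilon>0$ such that every $\mathbf{x}$ with $\|\nabla g(\mathbf{x})\|\le\bar\epsilon$ satisfies $\mathrm{dist}(\mathbf{x},\{\mathbf{y}:\nabla g(\mathbf{y})=0\})\le c\|\nabla g(\mathbf{x})\|$. *)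

(* Defs.v *)
From HB Require Import structures.
From mathcomp Require Import all_boot all_order all_algebra.
From mathcomp Require Import all_classical all_reals all_analysis.
Import Order.TTheory GRing.Theory Num.Theory.
Import numFieldNormedType.Exports.

Set Implicit Arguments.
Unset Strict Implicit.
Unset Printing Implicit Defensive.

Local Open Scope classical_set_scope.
Local Open Scope ring_scope.

(* Vectors of R^n are row vectors, as required by the library's Jacobian 'J,  *)
(* and linear maps act by right multiplication.  The library norm `|x| on     *)
(* 'rV[R]_n is the sup norm; it is used below only through the topology and   *)
(* the notion of differentiability, which do not depend on the choice of norm.*)

Definition enorm (R : realType) (n : nat) (x : 'rV[R]_n) : R :=
  Num.sqrt (\sum_(i < n) x 0 i ^+ 2).

(* The set is nonempty and bounded above, so the real supremum is genuine.    *)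
Definition opnorm (R : realType) (n : nat) (A : 'M[R]_n) : R :=
  sup [set enorm (v *m A) | v in [set v : 'rV[R]_n | enorm v <= 1]].

(* Extended-real valued, so that the distance to the empty set is +oo.        *)
Definition euclidean_dist (R : realType) (n : nat) (x : 'rV[R]_n)
    (A : set 'rV[R]_n) : \bar R :=
  ereal_inf [set (enorm (x - y))%:E | y in A].

Definition grad (R : realType) (n : nat) (f : 'rV[R]_n -> R) (x : 'rV[R]_n)
    : 'rV[R]_n :=
  \row_(j < n) 'D_(delta_mx 0 j) f x.

(* Entry (i, j) is the i-th partial derivative of the j-th component of the   *)
(* gradient, so the product of the Hessian with the vector w is               *)
(* w *m hessian g x.                                                          *)
Definition hessian (R : realType) (n : nat) (g : 'rV[R]_n -> R) (x : 'rV[R]_n)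
    : 'M[R]_n :=
  'J (grad g) x.

Definition continuously_differentiable (R : realType) (n : nat)
    (f : 'rV[R]_n -> R) : Prop :=
  (forall x, differentiable f x) /\ continuous (grad f).

Definition twice_differentiable (R : realType) (n : nat)
    (g : 'rV[R]_n -> R) : Prop :=
  (forall x, differentiable g x) /\ (forall x, differentiable (grad g) x).

Definition lipschitz_grad (R : realType) (n : nat) (L : R)
    (f : 'rV[R]_n -> R) : Prop :=
  forall x y, enorm (grad f x - grad f y) <= L * enorm (x - y).

Definition lipschitz_hessian (R : realType) (n : nat) (L : R)
    (g : 'rV[R]_n -> R) : Prop :=
  forall x y, opnorm (hessian g x - hessian g y) <= L * enorm (x - y).

Definition attains_min (R : realType) (n : nat) (g : 'rV[R]_n -> R) : Prop :=
  exists z, forall x, g z <= g x.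

Definition local_error_bound (R : realType) (n : nat) (c ebar : R)
    (g : 'rV[R]_n -> R) : Prop :=
  [/\ 0 < c, 0 < ebar &
      forall x, enorm (grad g x) <= ebar ->
        (euclidean_dist x [set y | grad g y = 0%R] <= (c * enorm (grad g x))%:E)%E].

Definition stationary_point (R : realType) (n : nat) (f g : 'rV[R]_n -> R)
    (ef eg lambda : R) (x : 'rV[R]_n) : Prop :=
  [/\ 0 <= lambda,
      enorm (grad g x) ^+ 2 <= eg &
      enorm (grad f x + lambda *: grad g x) ^+ 2 <= ef].

Definition KKT_point (R : realType) (n : nat) (f g : 'rV[R]_n -> R)
    (ep ed : R) (x : 'rV[R]_n) : Prop :=
  exists w : 'rV[R]_n,
    enorm (grad f x + w *m hessian g x) ^+ 2 <= ep /\
    enorm (grad g x) ^+ 2 <= ed.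

(* Main.v *)
(** If xhat satisfies the error bound, pick y with grad g y = 0 and
    |y - xhat| <= 2 c |grad g xhat|, and take w = lambda (xhat - y).  Taylor's
    formula turns the Hessian term into lambda (grad g xhat + r) with
    |r| = O(|grad g xhat|^2), so the KKT residual is the stationarity residual
    plus lambda r.  For ef < 1, stationarity also bounds s = lambda |grad g xhat|
    by a constant, hence s^2 |grad g xhat|^2 = O(s eg).  When ef >= 1, or when
    |grad g xhat| exceeds the error bound threshold, w = 0 suffices. *)
Require Import Defs.
From HB Require Import structures.
From mathcomp Require Import all_boot all_order all_algebra.
From mathcomp Require Import all_classical all_reals all_analysis.
From mathcomp Require Import ring lra.
Import Order.TTheory GRing.Theory Num.Theory.
Import numFieldNormedType.Exports.
Local Open Scope classical_set_scope.
Local Open Scope ring_scope.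

Definition dot {R : realType} {n : nat} (u v : 'rV[R]_n) : R :=
  \sum_(i < n) u 0 i * v 0 i.

Section EuclideanNorm.
Context {R : realType} {n : nat}.
Implicit Types (u v w : 'rV[R]_n) (A : 'M[R]_n).

Lemma dotDl u v w : dot (u + v) w = dot u w + dot v w.
Proof. by rewrite -big_split; apply: eq_bigr => i _; rewrite mxE mulrDl. Qed.

Lemma dotZl a u v : dot (a *: u) v = a * dot u v.
Proof. by rewrite mulr_sumr; apply: eq_bigr => i _; rewrite mxE mulrA. Qed.

Lemma dotC u v : dot u v = dot v u.
Proof. by apply: eq_bigr => i _; rewrite mulrC. Qed.

Lemma dotBl u v w : dot (u - v) w = dot u w - dot v w.
Proof. by rewrite dotDl -scaleN1r dotZl mulN1r. Qed.

Lemma enorm_ge0 u : 0 <= enorm u.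
Proof. exact: sqrtr_ge0. Qed.

Lemma enorm_sqr u : enorm u ^+ 2 = dot u u.
Proof. by rewrite sqr_sqrtr // sumr_ge0 // => i _; rewrite sqr_ge0. Qed.

Lemma enorm_eq0 u : enorm u = 0 -> u = 0.
Proof.
move=> u0; have : dot u u = 0 by rewrite -enorm_sqr u0 expr0n.
move/psumr_eq0P => H; apply/rowP => i; rewrite mxE.
by apply/eqP; rewrite -sqrf_eq0 expr2 H // => j _; rewrite -expr2 sqr_ge0.
Qed.

Lemma enorm0 : enorm (0 : 'rV[R]_n) = 0.
Proof. by rewrite /enorm big1 ?sqrtr0 // => i _; rewrite mxE expr0n. Qed.

Lemma enormZ a u : enorm (a *: u) = `|a| * enorm u.
Proof.
rewrite /enorm -sqrtr_sqr -sqrtrM ?sqr_ge0 // mulr_sumr.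
by congr Num.sqrt; apply: eq_bigr => i _; rewrite mxE exprMn.
Qed.

Lemma enormN u : enorm (- u) = enorm u.
Proof. by rewrite -scaleN1r enormZ normrN1 mul1r. Qed.

Lemma enormB_sqr u v : enorm (u - v) ^+ 2 =
  enorm u ^+ 2 - 2 * dot u v + enorm v ^+ 2.
Proof.
rewrite !enorm_sqr dotBl ![dot _ (u - v)]dotC !dotBl (dotC v u).
by ring.
Qed.

(** Parallelogram identity with the term [enorm (u - v) ^+ 2] dropped. *)
Lemma enormD_sqr_le u v :
  enorm (u + v) ^+ 2 <= 2 * enorm u ^+ 2 + 2 * enorm v ^+ 2.
Proof.
have uNv : dot u (- v) = - dot u v by rewrite dotC -scaleN1r dotZl mulN1r dotC.
have := enormB_sqr u v; have := enormB_sqr u (- v); rewrite opprK enormN uNv.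
have := sqr_ge0 (enorm (u - v)); lra.
Qed.

(** Cauchy-Schwarz: the square of $\|\,|v|u-|u|v\,\|$ equals $2|u||v|(|u||v|-u\cdot v)$, and the
    positive factor cancels once zero vectors are set aside. *)
Lemma dot_le_enorm u v : dot u v <= enorm u * enorm v.
Proof.
have [/eqP|un0] := eqVneq (enorm u * enorm v) 0.
  rewrite mulf_eq0 => /orP[] /eqP e0; rewrite e0 (enorm_eq0 _ e0).
    by rewrite mul0r -(scale0r v) dotZl mul0r.
  by rewrite mulr0 dotC -(scale0r u) dotZl mul0r.
have uv_gt0 : 0 < enorm u * enorm v.
  by rewrite lt_def un0 mulr_ge0 ?enorm_ge0.
have := sqr_ge0 (enorm (enorm v *: u - enorm u *: v)).
rewrite enormB_sqr !enormZ !ger0_norm ?enorm_ge0 // dotZl dotC dotZl dotC.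
rewrite (_ : _ + _ = 2 * (enorm u * enorm v) *
                     (enorm u * enorm v - dot u v)); last by ring.
by rewrite pmulr_rge0 ?subr_ge0 // mulr_gt0.
Qed.

(** Makes the supremum in [opnorm] a genuine least upper bound. The Frobenius norm is an upper
    bound, by Cauchy-Schwarz on each column. *)
Lemma opnorm_has_sup A :
  has_sup [set enorm (v *m A) | v in [set v : 'rV[R]_n | enorm v <= 1]].
Proof.
split; first by exists (enorm (0 *m A)), 0 => //=; rewrite enorm0 ler01.
exists (Num.sqrt (\sum_(j < n) enorm (col j A)^T ^+ 2)) => _ [v /= v1 <-].
apply: ler_wsqrtr; apply: ler_sum => j _.
have -> : (v *m A) 0 j = dot v (col j A)^T.
  by rewrite mxE; apply: eq_bigr => i _; rewrite !mxE.
have dle w : dot v w <= enorm w.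
  by apply: (le_trans (dot_le_enorm _ _)); rewrite ler_piMl ?enorm_ge0.
rewrite -(real_normK (num_real (dot _ _))) ler_sqr ?nnegrE ?enorm_ge0 //.
rewrite ler_norml dle andbT lerNl -mulN1r.
by rewrite dotC -dotZl dotC (le_trans (dle _)) // scaleN1r enormN.
Qed.

Lemma enorm_mulmx_le v A : enorm (v *m A) <= opnorm A * enorm v.
Proof.
have [v0|v0] := eqVneq (enorm v) 0.
  by rewrite (enorm_eq0 _ v0) mul0mx enorm0 mulr0.
have v_gt0 : 0 < enorm v by rewrite lt_def v0 enorm_ge0.
rewrite -ler_pdivrMr // mulrC -{1}[(enorm v)^-1]ger0_norm ?invr_ge0 ?enorm_ge0 //.
rewrite -enormZ scalemxAl; apply: (sup_upper_bound (opnorm_has_sup A)).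
exists ((enorm v)^-1 *: v) => //=.
by rewrite enormZ ger0_norm ?invr_ge0 ?enorm_ge0 // mulVf.
Qed.

End EuclideanNorm.

Section Taylor.
Context {R : realType} {n : nat}.

(** Chain rule along a line; pairing with a fixed [u] gives a scalar function, to which the mean
    value theorem applies. *)
Lemma is_derive_dot_line (F : 'rV[R]_n -> 'rV[R]_n) (x d u : 'rV[R]_n) (t : R) :
  differentiable F (x + t *: d) ->
  is_derive t 1 (fun s : R => dot (F (x + s *: d)) u)
    (dot (d *m 'J F (x + t *: d)) u).
Proof.
move=> dF.
pose G := fun s : R => F (x + s *: d).
have Gd : is_diff t G ('d F (x + t *: d) \o ( *:%R ^~ d)).
  have line : is_diff t (fun s : R => x + s *: d) (0 + ( *:%R ^~ d)).
    exact: is_diffD.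
  rewrite add0r in line.
  apply: (is_diff_comp line).
  exact: differentiableP.
have Gder : derivable G t 1 by apply: diff_derivable; exact: ex_diff.
have DG : 'D_1 G t = d *m 'J F (x + t *: d).
  by rewrite deriveE ?diff_val /= ?scale1r ?mul_rV_lin1.
have -> : (fun s : R => dot (F (x + s *: d)) u) =
    \sum_(j < n) (u 0 j \*: (fun s : R => (G s 0 j : R^o))).
  by apply/funext => s; rewrite fct_sumE; apply: eq_bigr => j _; rewrite /= mulrC.
have -> : dot (d *m 'J F (x + t *: d)) u =
    \sum_(j < n) (u 0 j *: ('D_1 (fun s : R => G s 0 j) t : R^o)).
  by apply: eq_bigr => j _; rewrite -DG derive_mx // mxE mulrC.
apply: is_derive_sum => j; apply: is_deriveZ; apply: DeriveDef => //.
by move/derivable_mxP: Gder; apply.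
Qed.

(** The mean value theorem is applied to [F] on the segment, paired with the remainder [r] itself:
    this expresses $|r|^2$ through a difference of Jacobians, and one factor $|r|$ cancels. The
    absolute value covers an [L] of unknown sign. *)
Lemma taylor_enorm_le (F : 'rV[R]_n -> 'rV[R]_n) (L : R) (x y : 'rV[R]_n) :
  (forall z, differentiable F z) ->
  (forall z w, opnorm ('J F z - 'J F w) <= L * enorm (z - w)) ->
  enorm (F y - F x - (y - x) *m 'J F x) <= `|L| * enorm (y - x) ^+ 2.
Proof.
move=> dF lipJ; set d := y - x; set r := F y - F x - d *m 'J F x.
have [->|r0] := eqVneq (enorm r) 0; first by rewrite mulr_ge0 ?sqr_ge0.
have r_gt0 : 0 < enorm r by rewrite lt_def r0 enorm_ge0.
have der t := @is_derive_dot_line F x d r t (dF _).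
have [|t tI] := MVT (f := fun s => dot (F (x + s *: d)) r) ltr01
  (fun t _ => der t).
  apply: derivable_within_continuous => s _; have := der s.
  exact: @ex_derive.
rewrite scale1r scale0r addr0 subr0 mulr1 (addrC x) subrK => mv.
have rr : enorm r ^+ 2 = dot (d *m ('J F (x + t *: d) - 'J F x)) r.
  by rewrite enorm_sqr {1}/r !dotBl mv -dotBl -mulmxBr.
rewrite -(ler_pM2r r_gt0) -expr2 rr.
apply: (le_trans (dot_le_enorm _ _)); rewrite ler_pM2r //.
apply: (le_trans (enorm_mulmx_le _ _)).
rewrite expr2 mulrA ler_wpM2r ?enorm_ge0 // (le_trans (lipJ _ _)) //.
rewrite [x + _]addrC addrK enormZ mulrA ler_wpM2r ?enorm_ge0 //.
have t1 : `|t| <= 1.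
  by move: tI; rewrite in_itv => /andP[t_gt0 /ltW]; rewrite gtr0_norm.
by rewrite (le_trans (ler_wpM2r (normr_ge0 t) (ler_norm L))) // ler_piMr.
Qed.

End Taylor.

(* The factor 2 leaves room to pick a point of the zero set without knowing
   that the infimum defining the distance is attained. *)
Lemma error_bound_zero {R : realType} {n : nat} {c ebar : R}
    {g : 'rV[R]_n -> R} (x : 'rV[R]_n) :
  local_error_bound c ebar g -> enorm (grad g x) <= ebar ->
  exists2 y, grad g y = 0 & enorm (y - x) <= 2 * c * enorm (grad g x).
Proof.
move=> [c_gt0 _ bound] xebar.
(* At a zero gradient the strict inequality $c|\nabla g(x)|<2c|\nabla g(x)|$ fails, but [x] itself
   is a zero. *)
have [gx0|gx0] := eqVneq (enorm (grad g x)) 0.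
  by exists x; [exact: enorm_eq0 | rewrite subrr enorm0 gx0 mulr0].
have gx_gt0 : 0 < enorm (grad g x) by rewrite lt_def gx0 enorm_ge0.
have lt2 : (euclidean_dist x [set y | grad g y = 0%R] <
            (2 * c * enorm (grad g x))%:E)%E.
  apply: (le_lt_trans (bound x xebar)).
  by rewrite lte_fin ltr_pM2r // ltr_pMl // ltr1n.
have [_ [y gy0 <-]] := ereal_inf_lt lt2; rewrite lte_fin => /ltW le2.
by exists y; rewrite // -opprB enormN.
Qed.

Theorem theorem3p2 (R : realType) (Gf Lf Lg LH c ebar : R) :
  exists C : R, 0 < C /\
    forall (n : nat) (f g : 'rV[R]_n -> R),
      continuously_differentiable f ->
      continuously_differentiable g ->
      (forall x : 'rV[R]_n, enorm (grad f x) <= Gf) ->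
      lipschitz_grad Lf f ->
      lipschitz_grad Lg g ->
      attains_min g ->
      twice_differentiable g ->
      lipschitz_hessian LH g ->
      local_error_bound c ebar g ->
      forall (ef eg lambda : R) (xhat : 'rV[R]_n),
        0 < ef -> 0 < eg ->
        stationary_point f g ef eg lambda xhat ->
        KKT_point f g (C * (ef + lambda * enorm (grad g xhat) * eg)) eg xhat.
Proof.
(* [M] will bound $s^2$ when [ef < 1], and [K] is the constant of the Taylor remainder at a point
   within $2c|\nabla g|$. *)
pose M := 2 + 2 * Gf ^+ 2.
pose K := `|LH| * (2 * c) ^+ 2.
have Gf2 : 0 <= Gf ^+ 2 by exact: sqr_ge0.
have K2M : 0 <= K ^+ 2 * M by rewrite mulr_ge0 ?sqr_ge0 // /M; lra.
have Me : 0 <= M / ebar ^+ 2.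
  by rewrite divr_ge0 ?sqr_ge0 // /M; lra.
(* The summands pay, in order, for the stationarity residual, the case [1 <= ef], the Taylor
   remainder, and the case above the threshold. The sign of [ebar] is not known yet; the last
   summand is nonnegative in any case. *)
exists (2 + Gf ^+ 2 + 2 * (K ^+ 2 * M) + 2 * (M / ebar ^+ 2)).
split; first lra.
move=> n f g _ _ fG _ _ _ [_ gdiff] gLH geb ef eg lambda x ef_gt0 eg_gt0.
move=> [lam_ge0 gx_le stat].
set a := enorm (grad g x); set s := lambda * a.
have a_ge0 : 0 <= a := enorm_ge0 _.
have s_ge0 : 0 <= s by rewrite mulr_ge0.
have seg_ge0 : 0 <= s * eg by rewrite mulr_ge0 // ltW.
set C := (X in X * (ef + s * eg)).
have target p q r t : 0 <= p <= 2 -> 0 <= q <= Gf ^+ 2 ->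
    0 <= r <= 2 * (K ^+ 2 * M) -> 0 <= t <= 2 * (M / ebar ^+ 2) ->
    (p + q) * ef + (r + t) * (s * eg) <= C * (ef + s * eg).
  move=> hp hq hr ht; rewrite mulrDr lerD // ler_wpM2r ?(ltW ef_gt0) // /C; lra.
have fx2 : enorm (grad f x) ^+ 2 <= Gf ^+ 2.
  by rewrite lerXn2r ?nnegrE ?(le_trans (enorm_ge0 _) (fG x)) ?enorm_ge0.
have w0 : enorm (grad f x) ^+ 2 <= C * (ef + s * eg) ->
    KKT_point f g (C * (ef + s * eg)) eg x.
  by move=> le; exists 0; rewrite mul0mx addr0.
have [ef1|ef1] := leP 1 ef.
  apply/w0/(le_trans fx2).
  apply: le_trans (target 0 (Gf ^+ 2) 0 0 _ _ _ _); try lra.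
  by rewrite add0r addr0 mul0r addr0 ler_peMr.
have lamg : enorm (lambda *: grad g x) = s by rewrite enormZ ger0_norm.
(* The target is linear in [s], so one factor is traded for [M]. Writing $\lambda\nabla g$ as the
   residual minus $\nabla f$ gives $s^2\le M$, hence $s\le M$ whether or not $s\le 1$. *)
have s2 : s ^+ 2 <= M * s.
  have : s ^+ 2 <= M.
    have := enormD_sqr_le (grad f x + lambda *: grad g x) (- grad f x).
    rewrite [grad f x + _]addrC addrK lamg enormN addrC.
    move: stat; rewrite addrC /M; lra.
  move=> sM; rewrite expr2 ler_wpM2r //.
  have [|/ltW s1] := leP s 1; first by rewrite /M; lra.
  by apply: le_trans sM; rewrite expr2 ler_peMr.
(* Above the threshold [eg] is at least [ebar ^+ 2], so $|\nabla f|^2\le 2\epsilon_f+2s^2$ and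
   $s^2\le Ms$ suffice with [w = 0]. *)
have [gx_ebar|gx_ebar] := leP a ebar; last first.
  have ebar_gt0 : 0 < ebar by case: geb.
  have eg_ge : ebar ^+ 2 <= eg.
    by rewrite (le_trans _ gx_le) // lerXn2r ?nnegrE ?(ltW ebar_gt0) //
      ltW.
  apply/w0.
  apply: le_trans (target 2 0 0 (2 * (M / ebar ^+ 2)) _ _ _ _); try lra.
  have := enormD_sqr_le (grad f x + lambda *: grad g x) (- (lambda *: grad g x)).
  rewrite addrK enormN lamg => /le_trans; apply.
  have : M * s <= M / ebar ^+ 2 * (s * eg).
    rewrite -mulrA ler_wpM2l //; first by rewrite /M; lra.
    by rewrite mulrC -mulrA ler_peMr // ler_pdivlMr ?mul1r ?exprn_gt0.
  lra.
have [y gy0 xy] := error_bound_zero x geb gx_ebar.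
exists (- (lambda *: (y - x))); split=> //.
set r := grad g y - grad g x - (y - x) *m hessian g x.
have r_le : enorm r <= K * a ^+ 2.
  apply: (le_trans (@taylor_enorm_le _ _ (grad g) LH x y gdiff gLH)).
  rewrite /K -mulrA ler_wpM2l // -exprMn.
  by rewrite lerXn2r ?nnegrE ?enorm_ge0 // (le_trans (enorm_ge0 _) xy).
(* As $\nabla g(y)=0$, the definition of [r] gives $-(y-x)\nabla^2g(x)=\nabla g(x)+r$. *)
have -> : grad f x + - (lambda *: (y - x)) *m hessian g x =
    (grad f x + lambda *: grad g x) + lambda *: r.
  rewrite /r gy0 sub0r [lambda *: (- _ - _)]scalerBr scalerN mulNmx -scalemxAl.
  by rewrite -!addrA addNKr.
apply: le_trans (enormD_sqr_le _ _) _.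
apply: le_trans (target 2 0 (2 * (K ^+ 2 * M)) 0 _ _ _ _); try lra.
(* $\lambda^2|r|^2\le K^2\lambda^2a^4=K^2s^2a^2$, then $s^2\le Ms$ and $a^2\le\epsilon_g$. *)
have : enorm (lambda *: r) ^+ 2 <= K ^+ 2 * M * (s * eg).
  rewrite enormZ ger0_norm //.
  have : (lambda * enorm r) ^+ 2 <= (lambda * (K * a ^+ 2)) ^+ 2.
    have K_ge0 : 0 <= K by rewrite mulr_ge0 ?sqr_ge0.
    by rewrite lerXn2r ?nnegrE ?ler_wpM2l ?(mulr_ge0 lam_ge0) ?(mulr_ge0 K_ge0) ?sqr_ge0 ?enorm_ge0.
  move=> /le_trans; apply.
  have -> : (lambda * (K * a ^+ 2)) ^+ 2 = K ^+ 2 * (s ^+ 2 * a ^+ 2).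
    by rewrite /s; ring.
  by rewrite -(mulrA (K ^+ 2) M) ler_wpM2l ?sqr_ge0 // (mulrA M) ler_pM ?sqr_ge0.
lra.
Qed.
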